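(* Suppose a graph $G$ has a convex compact visibility representation in which two sightlines $\overline{ab}$ and $\overline{vw}$ intersect, where $a,b,v,w$ lie in four distinct regions $A,B,V,W$ respectively. Then the vertices $A$ and $B$ lie in a common subgraph of $G$ isomorphic to $K_4$.
   Context: All graphs are finite and simple. Given a family of pairwise disjoint nonempty connected subsets (''regions'') of $\mathbb{R}^2$, a sightline is a closed line segment $\overline{ab}$ with $a\in A$, $b\in B$ for two different regions $A\neq B$ of the family, such that the segment intersects no region of the family other than $A$ and $B$. A visibility representation of $G$ is such a family with one region per vertex, such that two distinct vertices are adjacent in $G$ if and only if there is a sightline between their regions; it is convex compact if every region is compact and convex. Vertices are identified with their regions. *)

(* Defs.v *)
From HB Require Import structures.
From mathcomp Require Import all_boot all_order all_algebra.
From mathcomp Require Import all_classical all_reals all_analysis.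
Set Implicit Arguments. Unset Strict Implicit. Unset Printing Implicit Defensive.
Import Order.TTheory GRing.Theory Num.Theory.
Import numFieldNormedType.Exports.
Local Open Scope classical_set_scope.
Local Open Scope ring_scope.

Definition plane (R : realType) := 'rV[R]_2.

Definition segment (R : realType) (a b : plane R) : set (plane R) :=
  [set x | exists t : R, 0 <= t <= 1 /\ x = (1 - t) *: a + t *: b].

Definition convex_region (R : realType) (X : set (plane R)) : Prop :=
  forall x y, X x -> X y -> segment x y `<=` X.

Definition simple_graph (T : finType) (e : rel T) : Prop :=
  symmetric e /\ irreflexive e.

Definition region_family (R : realType) (T : finType) (reg : T -> set (plane R)) : Prop :=
  (forall x, reg x !=set0) /\ (forall x, connected (reg x)) /\
  (forall x y, x != y -> reg x `&` reg y = set0).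

Definition sightline (R : realType) (T : finType) (reg : T -> set (plane R))
  (x y : T) (a b : plane R) : Prop :=
  x != y /\ reg x a /\ reg y b /\
  (forall z, z != x -> z != y -> segment a b `&` reg z = set0).

Definition visibility_rep (R : realType) (T : finType) (e : rel T)
  (reg : T -> set (plane R)) : Prop :=
  region_family reg /\
  (forall x y, x != y -> (e x y <-> exists a b, sightline reg x y a b)).

Definition convex_compact_visibility_rep (R : realType) (T : finType) (e : rel T)
  (reg : T -> set (plane R)) : Prop :=
  visibility_rep e reg /\ (forall x, convex_region (reg x) /\ compact (reg x)).

Definition in_common_K4 (T : finType) (e : rel T) (A B : T) : Prop :=
  exists C D : T, [/\ uniq [:: A; B; C; D],
     e A B, e A C, e A D & [/\ e B C, e B D & e C D]].

(* Main.v *)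
Require Import Defs.
From mathcomp Require Import all_boot all_order all_algebra.
From mathcomp Require Import all_classical all_reals all_analysis.
From mathcomp Require Import ring lra.
Import Order.TTheory GRing.Theory Num.Theory.
Import numFieldNormedType.Exports.
Local Open Scope classical_set_scope.
Local Open Scope ring_scope.

(** Clip every region to the hull [Q] of [a], [b], [v], [w] and take affine
    coordinates in which [vw] lies on [X = 0] and [ab] on [Y = 0].  Inside [Q],
    [A] is then to the left of [X = 0], [B] to the right, and every other region
    (an obstacle) is strictly above or strictly below [Y = 0].  Among the pairs
    [a'] of [A], [b'] of [B] whose segment weakly separates the upper obstacles
    from the lower ones, take one of least width [X b' - X a'].

    If no lower obstacle touches [a'b'], minimality keeps [A] and [B] out of the
    part of the strip between [a'] and [b'] below the line [a'b'], so the lower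
    obstacle point of the triangle [a'b'w] closest to that line (the apex) sees
    [a'], [b'] and every obstacle point touching [a'b'].  If some lower obstacle
    does touch [a'b'], its touching point plays the role of the apex: the
    original sightline [ab] provides a point of [A] or of [B] towards which the
    segment can be tilted to get past the other touching obstacles.  The same
    holds above, and one upper and one lower region complete the [K4]. *)

(** * Segments, minima on compact sets and small perturbations *)

Definition point_at {R : realType} (p q : plane R) (t : R) : plane R :=
  (1 - t) *: p + t *: q.

Lemma point_at0 {R : realType} (p q : plane R) : point_at p q 0 = p.
Proof. by rewrite /point_at subr0 scale1r scale0r addr0. Qed.

Lemma point_at1 {R : realType} (p q : plane R) : point_at p q 1 = q.
Proof. by rewrite /point_at subrr scale0r scale1r add0r. Qed.

Lemma point_atC {R : realType} (p q : plane R) (t : R) :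
  point_at p q t = point_at q p (1 - t).
Proof. by rewrite /point_at opprB addrC subrKC. Qed.

Lemma segment_sym {R : realType} (p q : plane R) : segment p q = segment q p.
Proof.
suff sub (r s : plane R) : segment r s `<=` segment s r.
  by apply/seteqP; split; apply: sub.
move=> x [t [t01 ->]]; exists (1 - t); split; first lra.
exact: point_atC.
Qed.

Lemma sightline_sym {R : realType} {T : finType} {reg : T -> set (plane R)}
    {x y : T} {p q : plane R} :
  sightline reg x y p q -> sightline reg y x q p.
Proof.
move=> [xy [xp [yq free]]]; split; first by rewrite eq_sym.
by do 2![split=> //] => z zy zx; rewrite segment_sym; apply: free.
Qed.

Lemma continuous_point_at {R : realType} {E : topologicalType}
    (f g : E -> plane R) (s : E -> R) :
  continuous f -> continuous g -> continuous s ->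
  continuous (fun x => point_at (f x) (g x) (s x)).
Proof.
move=> cf cg cs x; apply: cvgD; apply: cvgZ.
- by apply: cvgB; [exact: cvg_cst | exact: cs].
- exact: cf.
- exact: cs.
- exact: cg.
Qed.

Lemma compact_argmin {R : realType} {E : topologicalType} {S : set E} {f : E -> R} :
  compact S -> S !=set0 -> continuous f ->
  exists2 p, S p & forall q, S q -> f p <= f q.
Proof.
move=> cS S0 cf.
have [p pS pmin] := compact_EVT_min S0 cS (continuous_subspaceT cf).
exists p; first by rewrite inE in pS.
by move=> q Sq; apply: pmin; rewrite inE.
Qed.

Lemma closed_le0_preimage {R : realType} {E : topologicalType} (f : E -> R) :
  continuous f -> closed [set x | f x <= 0].
Proof. by move=> cf; apply: (preimage_closed (fun x _ => cf x) (@closed_le R 0)). Qed.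

Lemma closed_ge0_preimage {R : realType} {E : topologicalType} (f : E -> R) :
  continuous f -> closed [set x | 0 <= f x].
Proof. by move=> cf; apply: (preimage_closed (fun x _ => cf x) (@closed_ge R 0)). Qed.

(** The pairs of a tilt and a position at which the tilted segment meets [K] form a compact set, so
    there is a least bad tilt; it is positive because the segment at tilt [0] misses [K]. *)
Lemma segment_perturb {R : realType} {K : set (plane R)} {p : plane R}
    (q : plane R) {t : plane R} :
  compact K -> segment p t `&` K = set0 ->
  exists2 s0 : R, 0 < s0 <= 1 &
    forall s, 0 <= s <= s0 -> segment (point_at p q s) t `&` K = set0.
Proof.
move=> cK free.
pose f (x : R * R) := point_at (point_at p q x.1) t x.2.
have cf : continuous f.
  apply: continuous_point_at; last by move=> x; exact: cvg_snd.
    apply: continuous_point_at; last by move=> x; exact: cvg_fst.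
      by move=> x; exact: cvg_cst.
    by move=> x; exact: cvg_cst.
  by move=> x; exact: cvg_cst.
pose S := (`[0, 1] `*` `[0, 1]) `&` f @^-1` K.
have cS : compact S.
  apply: compact_closedI; first by apply: compact_setX; exact: segment_compact.
  apply: preimage_closed; first by move=> x _; exact: cf.
  by apply: compact_closed => //; exact: norm_hausdorff.
have meets s x : 0 <= s <= 1 -> segment (point_at p q s) t x -> K x ->
    exists u, S (s, u).
  move=> s01 [u [u01 xE]] Kx; exists u; split; last by rewrite /f /= /preimage /= /point_at -xE.
  by split; rewrite /= in_itv.
have [S0|/nonemptyPn S0] := pselect (S !=set0); last first.
  exists 1; first lra.
  move=> s s01; apply/seteqP; split => // x [sx Kx].
  by have [u] := meets s x s01 sx Kx; rewrite S0.
have [[s1 u1] Ss smin] := @compact_argmin R _ S fst cS S0 (fun x => cvg_fst).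
case: (Ss) => -[] /=; rewrite !in_itv /= => /andP[s1ge0 s1le1] u01 Kf.
have s1gt0 : 0 < s1.
  rewrite lt_neqAle s1ge0 andbT; apply/negP => /eqP s10.
  suff : (segment p t `&` K) (f (s1, u1)) by rewrite free.
  split => //; exists u1; split=> //.
  by rewrite /f /= -s10 point_at0.
(* Half of the least bad tilt, because the claim includes [s0] itself. *)
exists (s1 / 2); first lra.
move=> s sle; apply/seteqP; split => // x [sx Kx].
have s01 : 0 <= s <= 1 by lra.
have [u Su] := meets s x s01 sx Kx.
have /= := smin _ Su; lra.
Qed.

Lemma compact_finite_union {R : realType} {T : finType} (P : pred T)
    (F : T -> set (plane R)) :
  (forall z, P z -> compact (F z)) -> compact [set p | exists2 z, P z & F z p].
Proof.
move=> cF.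
have -> : [set p | exists2 z, P z & F z p]
    = \bigcup_(z in [set z | (z \in enum T) && P z]) F z.
  apply/seteqP; split => p [z Pz Fz]; exists z => //=; first by rewrite mem_enum.
  by case/andP: Pz.
by rewrite bigcup_seq_cond; apply: bigsetU_compact.
Qed.

(** * Affine charts and the signed height over a line *)

(** A pair of affine coordinates given by its properties instead of a matrix, so that negating or
    exchanging the coordinates visibly yields a chart again. *)
Record affine_chart {R : realType} {X Y : plane R -> R} : Prop := AffineChart {
  chart_contl : continuous X;
  chart_contr : continuous Y;
  chart_affl : forall p q t, X (point_at p q t) = (1 - t) * X p + t * X q;
  chart_affr : forall p q t, Y (point_at p q t) = (1 - t) * Y p + t * Y q;
  chart_inj : forall p q, X p = X q -> Y p = Y q -> p = q }.
Arguments affine_chart {R} X Y.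

(* The signed vertical distance from [r] to the line [pq], scaled by
   [X q - X p]; it is unchanged when [p], [q] and the sign of [X] are swapped. *)
Definition height {R : realType} (X Y : plane R -> R) (p q r : plane R) : R :=
  (Y r - Y p) * (X q - X p) - (Y q - Y p) * (X r - X p).

Lemma height_oppl {R : realType} (X Y : plane R -> R) (p q r : plane R) :
  height (fun x => - X x) Y q p r = height X Y p q r.
Proof. by rewrite /height; ring. Qed.

Lemma height_oppr {R : realType} (X Y : plane R -> R) (p q r : plane R) :
  height X (fun x => - Y x) p q r = - height X Y p q r.
Proof. by rewrite /height; ring. Qed.

Lemma continuous_opp_fun {R : realType} {E : topologicalType} {f : E -> R} :
  continuous f -> continuous (fun x => - f x).
Proof. by move=> cf x; apply: cvgN; exact: cf. Qed.

Lemma continuous_sub_fun {R : realType} {E : topologicalType} {f g : E -> R} :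
  continuous f -> continuous g -> continuous (fun x => f x - g x).
Proof. by move=> cf cg x; apply: continuousB; [exact: cf|exact: cg]. Qed.

Lemma continuous_mul_fun {R : realType} {E : topologicalType} {f g : E -> R} :
  continuous f -> continuous g -> continuous (fun x => f x * g x).
Proof. by move=> cf cg x; apply: continuousM; [exact: cf|exact: cg]. Qed.

Section Chart.
Context {R : realType} {X Y : plane R -> R} (XY : affine_chart X Y).
Implicit Types p q r z : plane R.

Let affE := (chart_affl XY, chart_affr XY).

Lemma chart_oppl : affine_chart (fun x => - X x) Y.
Proof.
split; try by case: XY.
- by apply: continuous_opp_fun; exact: chart_contl XY.
- by move=> p q t; rewrite affE; ring.
- by move=> p q /oppr_inj; exact: chart_inj XY p q.
Qed.

Lemma chart_oppr : affine_chart X (fun x => - Y x).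
Proof.
split; try by case: XY.
- by apply: continuous_opp_fun; exact: chart_contr XY.
- by move=> p q t; rewrite affE; ring.
- by move=> p q eX /oppr_inj; exact: chart_inj XY p q eX.
Qed.

Lemma height_affine p q r z t :
  height X Y p q (point_at r z t)
  = (1 - t) * height X Y p q r + t * height X Y p q z.
Proof. by rewrite /height !affE; ring. Qed.

Lemma height_startpoint p q : height X Y p q p = 0.
Proof. by rewrite /height; ring. Qed.

Lemma continuous_height p q : continuous (height X Y p q).
Proof.
have [cX cY] := (chart_contl XY, chart_contr XY).
apply: continuous_sub_fun; apply: continuous_mul_fun.
- by apply: continuous_sub_fun => //; exact: cst_continuous.
- exact: cst_continuous.
- exact: cst_continuous.
- by apply: continuous_sub_fun => //; exact: cst_continuous.
Qed.

Lemma segment_height0 {p q r} : segment p q r -> height X Y p q r = 0.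
Proof. by move=> [t [_ ->]]; rewrite -/(point_at p q t) /height !affE; ring. Qed.

Lemma segment_strip {p q r} : X p < X q -> segment p q r -> X p <= X r <= X q.
Proof. by move=> pq [t [t01 ->]]; rewrite -/(point_at p q t) affE; apply/andP; split; nra. Qed.

Lemma height0_segment {p q r} :
  X p < X q -> X p <= X r <= X q -> height X Y p q r = 0 -> segment p q r.
Proof.
rewrite /height => pq rpq h0.
have D0 : 0 < X q - X p by lra.
have Dn0 : X q - X p != 0 by rewrite gt_eqF.
exists ((X r - X p) / (X q - X p)); split.
  by rewrite divr_ge0 ?ler_pdivrMr//; lra.
rewrite -/(point_at _ _ _); apply: (chart_inj XY); rewrite affE; first by field.
apply: (mulIf Dn0); rewrite -[LHS]subr0 -h0; field.
by [].
Qed.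

(* If [q] lies below the segment [pr] then, as [p] slides towards [q], the
   segment to [r] sweeps the triangle [p q' r]. *)
Lemma swept_triangle {p q r z : plane R} {s : R} :
  0 < s <= 1 -> X p < X q -> X q < X r -> height X Y p r q < 0 ->
  X (point_at p q s) < X z < X r -> height X Y p r z <= 0 ->
  0 < height X Y (point_at p q s) r z ->
  exists2 s' : R, 0 <= s' <= s & segment (point_at p q s') r z.
Proof.
move=> s01 pq qr hq0 zs hz0 hz'.
have D0 : 0 < X r - X p by lra.
have Dn0 : X r - X p != 0 by rewrite gt_eqF.
(* The barycentric coordinates of [z] over [p], [q], [r] are [u - m], [m], [1 - u]: the height over
   [pr] determines [m], the abscissa then determines [u], and the slid endpoint has parameter
   [m / u]. *)
set m := height X Y p r z / height X Y p r q.
have hz : height X Y p r z = m * height X Y p r q.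
  by rewrite /m divfK// lt_eqF.
have m0 : 0 <= m by rewrite /m -mulrNN -invrN mulr_ge0 ?invr_ge0; lra.
clearbody m.
have Xs : X (point_at p q s) = (1 - s) * X p + s * X q by rewrite affE.
(* The hypothesis that [z] is strictly above the last swept segment, multiplied out; in terms of the
   [u] below it says [m < s * u]. *)
have key : m * (X r - X (point_at p q s)) < s * (X r - X z).
  have : (X r - X p) * height X Y (point_at p q s) r z
      = height X Y p r z * (X r - X (point_at p q s))
        - s * height X Y p r q * (X r - X z).
    by rewrite /height !affE; ring.
  rewrite hz => e; have : 0 < (X r - X p) * height X Y (point_at p q s) r z.
    exact: mulr_gt0.
  rewrite e => ineq.
  have : 0 < (s * (X r - X z) - m * (X r - X (point_at p q s)))
            * (- height X Y p r q) by nra.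
  by rewrite pmulr_lgt0; lra.
have ms : m < s.
  have : m * (X r - X (point_at p q s)) < s * (X r - X (point_at p q s)) by nra.
  by rewrite ltr_pM2r//; lra.
set u := (X r - X z + m * (X q - X p)) / (X r - X p).
have uD : u * (X r - X p) = X r - X z + m * (X q - X p) by rewrite /u divfK.
have u0 : 0 < u by rewrite /u divr_gt0//; nra.
have u1 : u <= 1 by rewrite /u ler_pdivrMr//; nra.
clearbody u.
have msu : m <= s * u.
  rewrite -(ler_pM2r D0) -mulrA uD; nra.
have mu : m / u * u = m by rewrite divfK// gt_eqF.
exists (m / u); first by rewrite divr_ge0 ?ler_pdivrMr ?(ltW u0)//.
exists (1 - u); split; first lra.
rewrite -/(point_at _ _ _).
move: (m / u) mu => n mu.
apply: (chart_inj XY); rewrite !affE.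
  nra.
apply: (mulIf Dn0).
have e : (Y z - Y p) * (X r - X p) = m * height X Y p r q + (Y r - Y p) * (X z - X p).
  by rewrite -hz /height; ring.
rewrite -[LHS](subrK (Y p * (X r - X p))) -mulrBl e /height.
have Xz : X z = X r + m * (X q - X p) - u * (X r - X p) by lra.
rewrite Xz -mu; ring.
Qed.

End Chart.

(** * Crossings, separating segments and tight segments *)

Definition obstacle {R : realType} {T : finType} (K : T -> set (plane R)) (A B : T) :
    set (plane R) :=
  [set p | exists2 z, (z != A) && (z != B) & K z p].

(* The situation after clipping every region to the hull of [a], [b], [v], [w]:
   [ab] is the part of [Y = 0], and [vw] the part of [X = 0], in that hull. *)
Record crossing {R : realType} {T : finType} {K : T -> set (plane R)}
    {X Y : plane R -> R} {A B : T} {a b v w : plane R} : Prop := Crossing {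
  cr_chart : affine_chart X Y;
  cr_compact : forall z, compact (K z);
  cr_convex : forall z p q t, 0 <= t <= 1 -> K z p -> K z q -> K z (point_at p q t);
  cr_disjoint : forall z z' p, K z p -> K z' p -> z = z';
  cr_left : forall p, K A p -> X p < 0;
  cr_right : forall p, K B p -> 0 < X p;
  cr_off_axis : forall p, obstacle K A B p -> Y p != 0;
  cr_start : K A a /\ Y a = 0;
  cr_end : K B b /\ Y b = 0;
  cr_top : [/\ obstacle K A B v, X v = 0 & 0 < Y v];
  cr_bottom : [/\ obstacle K A B w, X w = 0 & Y w < 0];
  cr_strip : forall z p, K z p -> X a <= X p <= X b }.
Arguments crossing {R T} K X Y A B a b v w.

(* Since an obstacle [p] has [Y p != 0], this says that inside the open strip
   between [a'] and [b'] the obstacles with [Y > 0] are weakly above the line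
   [a'b'] and those with [Y < 0] weakly below. *)
Definition separating {R : realType} {T : finType} (K : T -> set (plane R))
    (X Y : plane R -> R) (A B : T) (a' b' : plane R) : Prop :=
  [/\ K A a', K B b' &
    forall p, obstacle K A B p -> X a' < X p < X b' -> 0 <= Y p * height X Y a' b' p].

(** Horizontal width is minimised instead of length: moving an endpoint inwards reduces the width
    however the slope changes. *)
Definition tight {R : realType} {T : finType} (K : T -> set (plane R))
    (X Y : plane R -> R) (A B : T) (a' b' : plane R) : Prop :=
  separating K X Y A B a' b' /\
  forall a'' b'', separating K X Y A B a'' b'' -> X b' - X a' <= X b'' - X a''.

(** The condition above the segment is the same predicate with [- Y] in place of [Y]. *)
Definition untouched_below {R : realType} {T : finType} (K : T -> set (plane R))
    (Y : plane R -> R) (A B : T) (a' b' : plane R) : Prop :=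
  forall p, obstacle K A B p -> Y p < 0 -> ~ segment a' b' p.

Definition sees {R : realType} {T : finType} (K : T -> set (plane R)) (x y : T) : Prop :=
  exists p q, sightline K x y p q.

Lemma sees_sym {R : realType} {T : finType} {K : T -> set (plane R)} {x y : T} :
  sees K x y -> sees K y x.
Proof. by move=> [p [q pq]]; exists q, p; exact: sightline_sym. Qed.

Lemma obstacleC {R : realType} {T : finType} (K : T -> set (plane R)) (A B : T) :
  obstacle K A B = obstacle K B A.
Proof.
by apply/seteqP; split => p [z nz Kz]; exists z => //; rewrite andbC.
Qed.

(** * Reflections, which reduce later cases to one side *)

Section Flip.
Context {R : realType} {T : finType} {K : T -> set (plane R)} {X Y : plane R -> R}.
Context {A B : T} {a b v w : plane R}.

Lemma crossing_oppl :
  crossing K X Y A B a b v w -> crossing K (fun p => - X p) Y B A b a v w.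
Proof.
case=> XY cK convK disjK left right off [Aa Ya] [Bb Yb] [ov Xv Yv] [ow Xw Yw] strip.
split=> //; rewrite 1?obstacleC//.
- exact: chart_oppl.
- by move=> p /right; lra.
- by move=> p /left; lra.
- by split=> //; rewrite 1?obstacleC// Xv oppr0.
- by split=> //; rewrite 1?obstacleC// Xw oppr0.
- by move=> z p /strip /andP[? ?]; apply/andP; split; lra.
Qed.

Lemma crossing_oppr :
  crossing K X Y A B a b v w -> crossing K X (fun p => - Y p) A B a b w v.
Proof.
case=> XY cK convK disjK left right off [Aa Ya] [Bb Yb] [ov Xv Yv] [ow Xw Yw] strip.
split=> //.
- exact: chart_oppr.
- by move=> p /off; rewrite oppr_eq0.
- by rewrite Ya oppr0.
- by rewrite Yb oppr0.
- by split=> //; lra.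
- by split=> //; lra.
Qed.

Lemma separating_oppl (p q : plane R) :
  separating K (fun x => - X x) Y B A q p <-> separating K X Y A B p q.
Proof.
split=> -[Kp Kq sep]; split=> // r or rpq.
  by have := sep r; rewrite obstacleC height_oppl; apply=> //; lra.
by have := sep r; rewrite obstacleC height_oppl; apply=> //; lra.
Qed.

Lemma separating_oppr (p q : plane R) :
  separating K X (fun x => - Y x) A B p q <-> separating K X Y A B p q.
Proof.
split=> -[Kp Kq sep]; split=> // r or rpq; have := sep r or rpq;
  by rewrite height_oppr mulrNN.
Qed.

Lemma tight_oppl (p q : plane R) :
  tight K X Y A B p q -> tight K (fun x => - X x) Y B A q p.
Proof.
move=> [sep min]; split; first exact/separating_oppl.
by move=> p' q' /separating_oppl /min; lra.
Qed.

Lemma tight_oppr (p q : plane R) :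
  tight K X Y A B p q -> tight K X (fun x => - Y x) A B p q.
Proof.
move=> [sep min]; split; first exact/separating_oppr.
by move=> p' q' /separating_oppr /min.
Qed.

End Flip.

(** * Tight segments: existence and consequences of minimality *)

Section Crossing.
Context {R : realType} {T : finType} {K : T -> set (plane R)} {X Y : plane R -> R}.
Context {A B : T} {a b v w : plane R} (C : crossing K X Y A B a b v w).

Let XY : affine_chart X Y := cr_chart C.
Let affE := (chart_affl XY, chart_affr XY).
Let disjK := cr_disjoint C.
Let convK := cr_convex C.
Let left := cr_left C.
Let right := cr_right C.
Let off_axis := cr_off_axis C.

Lemma crossing_neq : A != B.
Proof.
apply/eqP => AB; have [Aa _] := cr_start C.
have := left a Aa; have := right a; rewrite -AB => /(_ Aa); lra.
Qed.

Lemma compact_region_le0 (z : T) (f : plane R -> R) :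
  continuous f -> compact (K z `&` [set p | f p <= 0]).
Proof.
move=> cf; apply: compact_closedI; first exact: (cr_compact C).
exact: closed_le0_preimage.
Qed.

Lemma compact_obstacle : compact (obstacle K A B).
Proof.
apply: (@compact_finite_union _ _ (fun z => (z != A) && (z != B))) => z _.
exact: (cr_compact C).
Qed.

(** A convex region with points on both sides of [Y = 0] would meet that line, which obstacles
    avoid. *)
Lemma obstacle_sign (z : T) (p q : plane R) :
  z != A -> z != B -> K z p -> K z q -> 0 < Y p -> Y q < 0 -> False.
Proof.
move=> zA zB Kp Kq Yp Yq.
pose t := Y p / (Y p - Y q).
have Dn0 : Y p - Y q != 0 by rewrite gt_eqF//; lra.
have t01 : 0 <= t <= 1.
  by rewrite /t divr_ge0 ?ler_pdivrMr; lra.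
have /off_axis /eqP[] : obstacle K A B (point_at p q t).
  by exists z; [exact/andP | exact: convK].
by rewrite affE /t; field.
Qed.

(** Separating pairs form a closed subset of a compact product, since each obstacle point imposes a
    union of three weak inequalities. The pair [(a, b)] is one of them, so the width attains its
    minimum. *)
Lemma tight_exists : exists a' b', tight K X Y A B a' b'.
Proof.
have [cX cY] := (chart_contl XY, chart_contr XY).
pose S := (K A `*` K B) `&` \bigcap_(p in obstacle K A B)
  ([set x : plane R * plane R | X p - X x.1 <= 0] `|`
   [set x : plane R * plane R | X x.2 - X p <= 0] `|`
   [set x : plane R * plane R | 0 <= Y p * height X Y x.1 x.2 p]).
have fst_cont (f : plane R -> R) : continuous f ->
    continuous (fun x : plane R * plane R => f x.1).
  by move=> cf x; apply: continuous_comp; [exact: cvg_fst | exact: cf].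
have snd_cont (f : plane R -> R) : continuous f ->
    continuous (fun x : plane R * plane R => f x.2).
  by move=> cf x; apply: continuous_comp; [exact: cvg_snd | exact: cf].
have cst (c : R) : continuous (fun _ : plane R * plane R => c).
  exact: cst_continuous.
have SE x : S x <-> separating K X Y A B x.1 x.2.
  split=> [[[Ax Bx] sep]|[Ax Bx sep]]; split=> // p op.
    move=> /andP[xp px]; have := sep p op => -[[/=|/=]|//=]; lra.
  have [px|xp] := leP (X p) (X x.1); first by left; left => /=; lra.
  have [px|xp'] := leP (X x.2) (X p); first by left; right => /=; lra.
  by right; apply: sep => //; rewrite xp.
have cS : compact S.
  apply: compact_closedI.
    by apply: compact_setX; exact: (cr_compact C).
  apply: closed_bigI => p _; apply: closedU; first apply: closedU.
  - by apply: closed_le0_preimage; apply: continuous_sub_fun => //; exact: fst_cont.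
  - by apply: closed_le0_preimage; apply: continuous_sub_fun => //; exact: snd_cont.
  - apply: closed_ge0_preimage; rewrite /height.
    by repeat first [apply: continuous_sub_fun | apply: continuous_mul_fun];
      first [exact: cst | exact: fst_cont | exact: snd_cont].
have S0 : S !=set0.
  have [[Aa Ya] [Bb Yb]] := (cr_start C, cr_end C).
  exists (a, b); apply/SE; split=> //= p op pab.
  (* Over [ab] the height of [p] is [Y p] times the width, so the product is a square times a
     positive number. *)
  rewrite /height Ya Yb; have := left a Aa; have := right b Bb.
  have : 0 <= Y p * Y p by rewrite -expr2 sqr_ge0.
  nra.
have [] := @compact_argmin _ _ S (fun x => X x.2 - X x.1) cS S0.
  by apply: continuous_sub_fun; [exact: snd_cont | exact: fst_cont].
move=> [a' b'] /SE /= sep min; exists a', b'; split=> // a'' b'' sep'.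
by apply: (min (a'', b'')); apply/SE.
Qed.

Section Separating.
Context {a' b' : plane R} (sep : separating K X Y A B a' b').

Lemma separating_lt : X a' < X b'.
Proof. by have [/left ? /right ?] := sep; lra. Qed.

Lemma separating_above {p : plane R} : obstacle K A B p -> 0 < Y p ->
  X a' < X p < X b' -> 0 <= height X Y a' b' p.
Proof.
by move=> op Yp strip; have [_ _ /(_ p op strip)] := sep; rewrite pmulr_rge0.
Qed.

Lemma separating_below {p : plane R} : obstacle K A B p -> Y p < 0 ->
  X a' < X p < X b' -> height X Y a' b' p <= 0.
Proof.
by move=> op Yp strip; have [_ _ /(_ p op strip)] := sep; rewrite nmulr_rge0.
Qed.

(** Otherwise the point would be an endpoint of the segment, and the endpoints belong to [A] and
    [B], which are disjoint from obstacles. *)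
Lemma touch_inside {p : plane R} : obstacle K A B p -> segment a' b' p ->
  X a' < X p < X b'.
Proof.
have [Aa' Bb' _] := sep; have ab := separating_lt.
move=> [z /andP[zA zB] Kz] [t [t01 pE]].
have tne0 : t != 0.
  apply: contra zA => /eqP t0; apply/eqP; apply: (disjK _ _ p Kz).
  by rewrite pE t0 -/(point_at _ _ _) point_at0.
have tne1 : t != 1.
  apply: contra zB => /eqP t1; apply/eqP; apply: (disjK _ _ p Kz).
  by rewrite pE t1 -/(point_at _ _ _) point_at1.
have t0 : 0 < t by rewrite lt_neqAle eq_sym tne0; case/andP: t01.
have t1 : t < 1 by rewrite lt_neqAle tne1; case/andP: t01.
by rewrite pE -/(point_at _ _ _) affE; apply/andP; split; nra.
Qed.

End Separating.

(** Sliding [a'] towards such a [p] would give a narrower separating pair. Upper obstacles stay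
    above because the line does not rise. Lower ones stay below either because the line does not
    change, or because none touches it and the slide is small. *)
Lemma tight_start {a' b' p : plane R} :
  tight K X Y A B a' b' -> K A p -> X a' < X p -> height X Y a' b' p <= 0 ->
  height X Y a' b' p = 0 \/ untouched_below K Y A B a' b' -> False.
Proof.
move=> [sep min] Ap ap hp.
have [Aa' Bb' _] := sep; have ab := separating_lt sep.
have Xp := left p Ap; have Xb := right b' Bb'.
have D0 : 0 < X b' - X a' by lra.
(* Minimality is contradicted as soon as the lower obstacles survive the slide; the upper ones are
   handled here once and for all. *)
have improve s : 0 < s <= 1 -> (forall r, obstacle K A B r -> Y r < 0 ->
    X (point_at a' p s) < X r < X b' -> height X Y (point_at a' p s) b' r <= 0) ->
    False.
  move=> s01 below.
  have Xs : X a' < X (point_at a' p s) by rewrite affE; nra.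
  have : separating K X Y A B (point_at a' p s) b'.
    split=> //; first by apply: convK => //; lra.
    move=> r or /andP[sr rb].
    have := off_axis r or; rewrite neq_lt => /orP[Yr|Yr].
      by rewrite nmulr_rge0//; apply: below => //; rewrite sr.
    rewrite pmulr_rge0//.
    have hr : 0 <= height X Y a' b' r.
      by apply: (separating_above sep) => //; rewrite rb andbT; lra.
    (* For an upper obstacle both terms on the right are nonnegative, since [p] is weakly below the
       line. *)
    have e : (X b' - X a') * height X Y (point_at a' p s) b' r
        = height X Y a' b' r * (X b' - X (point_at a' p s))
          - s * height X Y a' b' p * (X b' - X r).
      by rewrite /height !affE; ring.
    rewrite -(pmulr_rge0 _ D0) e.
    have : 0 <= height X Y a' b' r * (X b' - X (point_at a' p s)).
      by rewrite mulr_ge0//; lra.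
    have : 0 <= s * (- height X Y a' b' p) * (X b' - X r).
      by rewrite !mulr_ge0//; lra.
    lra.
  by move=> /min; lra.
move: hp; rewrite le_eqVlt => /orP[/eqP hp0 _|hp [hp0|below]]; last 2 first.
- lra.
- have [s0 s001 free] : exists2 s0 : R, 0 < s0 <= 1 & forall s, 0 <= s <= s0 ->
      segment (point_at a' p s) b'
        `&` (obstacle K A B `&` [set r | Y r <= 0]) = set0.
    apply: segment_perturb.
      apply: compact_closedI; first exact: compact_obstacle.
      exact: closed_le0_preimage (chart_contr XY).
    apply/seteqP; split=> // r [sr [or /= Yr]]; apply: (below r or _ sr).
    by rewrite lt_neqAle Yr off_axis.
  apply: (improve s0 s001) => r or Yr srb; rewrite leNgt; apply/negP => hr.
  have pb : X p < X b' by lra.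
  have hr0 : height X Y a' b' r <= 0.
    apply: (separating_below sep) => //; move: srb; rewrite affE => /andP[? ?].
    by apply/andP; split=> //; nra.
  (* A lower obstacle point that ends up above the line was met by the segment during the slide,
     which the choice of [s0] forbids. *)
  have [s' s'0 sr] := swept_triangle XY s001 ap pb hp srb hr0 hr.
  suff : (segment (point_at a' p s') b'
      `&` (obstacle K A B `&` [set r | Y r <= 0])) r by rewrite free.
  by split=> //; split=> //=; exact: ltW.
(* Here [p] is on the line, so [a'] can move all the way to [p] without changing the line. *)
- apply: (improve 1); first lra.
  move=> r or Yr; rewrite point_at1 => /andP[pr rb].
  have hr : height X Y a' b' r <= 0.
    by apply: (separating_below sep) => //; rewrite rb andbT; lra.
  have e : (X b' - X a') * height X Y p b' r
      = height X Y a' b' r * (X b' - X p) - height X Y a' b' p * (X b' - X r).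
    by rewrite /height; ring.
  rewrite -(pmulr_rle0 _ D0) e hp0 mul0r subr0 mulr_le0_ge0//; lra.
Qed.

(* Tilting the segment [a't] about [t] towards [p] clears the obstacles that
   only touch it from above. *)
Lemma sees_by_tilting {a' b' p t : plane R} {z : T} :
  separating K X Y A B a' b' -> K A p -> height X Y a' b' p < 0 ->
  z != A -> K z t -> segment a' b' t -> X a' < X t ->
  (forall z' q, z' != A -> z' != z -> K z' q -> segment a' t q ->
    z' != B /\ 0 < Y q) ->
  sees K A z.
Proof.
move=> sep Ap hp zA Kt st at_ above.
have [Aa' Bb' _] := sep; have ab := separating_lt sep.
(* The closed parts that the tilted segment has to miss: everything not to the right of [a'],
   everything with [Y <= 0], and [B]. What then remains are upper obstacle points to the right of
   [a']. *)
pose F z' := (K z' `&` [set q | X q - X a' <= 0]) `|`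
  ((K z' `&` [set q | Y q <= 0]) `|` (if z' == B then K B else set0)).
pose G := [set q | exists2 z', (z' != A) && (z' != z) & F z' q].
have cG : compact G.
  apply: compact_finite_union => z' _.
  have [cX cY] := (chart_contl XY, chart_contr XY).
  apply: compactU; [|apply: compactU]; try exact: compact_region_le0.
    apply: compact_region_le0; apply: continuous_sub_fun => //.
    exact: cst_continuous.
  by case: ifP => _; [exact: (cr_compact C) | exact: compact0].
have disjG : segment a' t `&` G = set0.
  apply/seteqP; split=> // q [sq [z' /andP[z'A z'z]]].
  have above' Kq := above z' q z'A z'z Kq sq.
  move=> [[Kq /= Xq]|[[Kq /= Yq]|]].
  + have [Xq' _] := andP (segment_strip XY at_ sq).
    have qa : q = a'.
      have e : X q = X a' by lra.
      case: sq => u [u01 qE]; rewrite qE -/(point_at _ _ _).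
      move: e; rewrite qE -/(point_at _ _ _) affE => e.
      have -> : u = 0 by nra.
      by rewrite point_at0.
    by move/eqP: z'A; apply; apply: (disjK _ _ q Kq); rewrite qa.
  + by have [_] := above' Kq; lra.
  + case: eqP => [z'B|//] Bq; rewrite -z'B in Bq.
    by have [/eqP] := above' Bq.
have [s0 s001 free] := segment_perturb p cG disjG.
exists (point_at a' p s0), t.
have {}free := free s0 (ltac:(lra)).
split; first by rewrite eq_sym.
split; first by apply: convK => //; lra.
split=> // z' z'A z'z; apply/seteqP; split=> // q [sq Kq].
have nF : ~ F z' q.
  move=> Fq; suff : (segment (point_at a' p s0) t `&` G) q by rewrite free.
  by split=> //; exists z' => //; exact/andP.
have z'B : z' != B.
  by apply/eqP => z'B; apply: nF; right; right; rewrite z'B eqxx -z'B.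
have Xq : X a' < X q.
  by rewrite ltNge; apply/negP => Xq; apply: nF; left; split=> //=; lra.
have Yq : 0 < Y q.
  by rewrite ltNge; apply/negP => Yq; apply: nF; right; left.
have [u [u01 qE]] := sq; rewrite -/(point_at _ _ _) in qE.
have une1 : u != 1.
  apply: contra z'z => /eqP u1; apply/eqP; apply: (disjK _ _ q Kq).
  by rewrite qE u1 point_at1.
have u1 : u < 1 by rewrite lt_neqAle une1; case/andP: u01.
have oq : obstacle K A B q by exists z' => //; exact/andP.
have Xqb : X q < X b'.
  have [Xa' Xp Xb'] := And3 (left _ Aa') (left _ Ap) (right _ Bb').
  have [_ Xt] := andP (segment_strip XY ab st).
  have Xs : X (point_at a' p s0) < 0 by rewrite affE; nra.
  rewrite qE affE; nra.
(* An upper obstacle point is weakly above [a'b'], whereas the tilted segment is strictly below it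
   until it reaches [t]. *)
have := separating_above sep oq Yq; rewrite Xq Xqb => /(_ isT).
rewrite qE !(height_affine XY) height_startpoint (segment_height0 XY st) => hq.
have : 0 < (1 - u) * (s0 * - height X Y a' b' p) by rewrite !mulr_gt0//; lra.
lra.
Qed.

End Crossing.

(** * The apex below an untouched segment *)

Section Apex.
Context {R : realType} {T : finType} {K : T -> set (plane R)} {X Y : plane R -> R}.
Context {A B : T} {a b v w : plane R}.

Lemma tight_end {a' b' p : plane R} :
  crossing K X Y A B a b v w -> tight K X Y A B a' b' ->
  K B p -> X p < X b' -> height X Y a' b' p <= 0 ->
  height X Y a' b' p = 0 \/ untouched_below K Y A B a' b' -> False.
Proof.
move=> C tg Bp pb; rewrite -height_oppl => hp cond.
apply: (tight_start (crossing_oppl C) (tight_oppl _ _ tg) Bp _ hp); first by rewrite ltrN2.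
case: cond => [|below]; [by left | right] => q oq Yq.
by rewrite segment_sym; apply: below => //; rewrite obstacleC.
Qed.

(** The last clause is the use made of extremality: a view of [d] from a point on or above the line
    cannot be blocked strictly below the line. *)
Definition lower_apex (a' b' d : plane R) : Prop :=
  [/\ obstacle K A B d, Y d < 0, height X Y a' b' d < 0, X a' < X d < X b' &
    forall c t, 0 <= height X Y a' b' c -> X a' <= X c <= X b' -> 0 <= t < 1 ->
      height X Y a' b' (point_at c d t) < 0 -> forall z, ~ K z (point_at c d t)].

(** The lower obstacles in the triangle [a'b'w] form a compact set containing [w], and its point
    nearest to the line is the apex. A blocker below the line would be a nearer point of this set,
    or a point of [A] or [B] excluded by minimality. *)
Lemma lower_apex_exists {a' b' : plane R} :
  crossing K X Y A B a b v w -> tight K X Y A B a' b' ->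
  untouched_below K Y A B a' b' -> exists d, lower_apex a' b' d.
Proof.
move=> C tg below; have [sep _] := tg; have ab := separating_lt C sep.
have XY := cr_chart C.
have [cX cY] := (chart_contl XY, chart_contr XY).
have ch := continuous_height XY a' b'.
have [Aa' Bb' _] := sep.
have Xa' := cr_left C _ Aa'.
have Xb' := cr_right C _ Bb'.
have cst (c : R) : continuous (fun _ : plane R => c) by exact: cst_continuous.
have not_touching p : obstacle K A B p -> Y p < 0 -> X a' <= X p <= X b' ->
    height X Y a' b' p != 0.
  by move=> op Yp strip; apply/eqP => hp; exact: below op Yp (height0_segment XY ab strip hp).
have [ow Xw Yw] := cr_bottom C.
pose H := - height X Y a' b' w.
have H0 : 0 < H.
  have wstrip : X a' < X w < X b' by lra.
  have := separating_below sep ow Yw wstrip.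
  have := not_touching w ow Yw; rewrite neq_lt => /(_ ltac:(lra)) /orP[]; rewrite /H; lra.
(* The last two inequalities cut out the triangle [a'b'w] below the line. *)
pose S := obstacle K A B `&` [set p | Y p <= 0] `&` [set p | height X Y a' b' p <= 0] `&`
  [set p | 0 <= H * (X p - X a') - X a' * height X Y a' b' p] `&`
  [set p | 0 <= H * (X b' - X p) - - X b' * height X Y a' b' p].
have cS : compact S.
  apply: compact_closedI; [apply: compact_closedI; [apply: compact_closedI; [
    apply: compact_closedI; first exact: (compact_obstacle C)|]|]|].
  - exact: closed_le0_preimage.
  - exact: closed_le0_preimage.
  - by apply: closed_ge0_preimage; repeat first [exact: cX | exact: ch | exact: cst
      | apply: continuous_sub_fun | apply: continuous_mul_fun].
  - by apply: closed_ge0_preimage; repeat first [exact: cX | exact: ch | exact: cst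
      | apply: continuous_sub_fun | apply: continuous_mul_fun].
have Sw : S w.
  split; [split; [split; [split|]|]|] => //=.
  - exact: ltW.
  - by move: H0; rewrite /H; lra.
  - by rewrite Xw /H; lra.
  - by rewrite Xw /H; lra.
have [d [[[[od Yd] hd] /= ld] rd] dmin] :=
  compact_argmin cS (ex_intro _ w Sw) (continuous_opp_fun ch).
rewrite /= in Yd hd.
have Yd0 : Y d < 0.
  by rewrite lt_neqAle Yd (cr_off_axis C _ od).
have hd0 : height X Y a' b' d < 0.
  rewrite lt_neqAle hd andbT; apply: not_touching => //.
  by apply/andP; split; rewrite -subr_ge0 -(pmulr_rge0 _ H0); nra.
exists d; split=> //.
  by apply/andP; split; rewrite -subr_gt0 -(pmulr_rgt0 _ H0); nra.
move=> c t hc /andP[ac cb] /andP[t0 t1] hq z Kq.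
set q := point_at c d t in hq Kq.
have hqE : height X Y a' b' q = (1 - t) * height X Y a' b' c + t * height X Y a' b' d.
  exact: height_affine.
have Xq : X q = (1 - t) * X c + t * X d by rewrite (chart_affl XY).
(* The part of the strip above the line also satisfies the side inequalities of the triangle, so the
   whole segment from [c] to [d] does. *)
have lq : 0 <= H * (X q - X a') - X a' * height X Y a' b' q.
  have : 0 <= (1 - t) * (H * (X c - X a') + - X a' * height X Y a' b' c).
    by apply: mulr_ge0; [|apply: addr_ge0; apply: mulr_ge0]; lra.
  have : 0 <= t * (H * (X d - X a') - X a' * height X Y a' b' d) by exact: mulr_ge0.
  rewrite hqE Xq; lra.
have rq : 0 <= H * (X b' - X q) - - X b' * height X Y a' b' q.
  have : 0 <= (1 - t) * (H * (X b' - X c) + X b' * height X Y a' b' c).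
    by apply: mulr_ge0; [|apply: addr_ge0; apply: mulr_ge0]; lra.
  have : 0 <= t * (H * (X b' - X d) - - X b' * height X Y a' b' d) by exact: mulr_ge0.
  rewrite hqE Xq; lra.
have aq : X a' < X q by rewrite -subr_gt0 -(pmulr_rgt0 _ H0); nra.
have qb : X q < X b' by rewrite -subr_gt0 -(pmulr_rgt0 _ H0); nra.
have zA : z != A.
  by apply/eqP => zA; rewrite zA in Kq; apply: (tight_start C tg Kq aq (ltW hq)); right.
have zB : z != B.
  by apply/eqP => zB; rewrite zB in Kq; apply: (tight_end C tg Kq qb (ltW hq)); right.
have oq : obstacle K A B q by exists z => //; exact/andP.
have Yq : Y q < 0.
  have := cr_off_axis C _ oq; rewrite neq_lt => /orP[//|Yq].
  have := separating_above sep oq Yq; rewrite aq qb => /(_ isT); lra.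
(* As a proper combination of [c] and [d], the point [q] is strictly higher than [d], against the
   choice of [d]. *)
have /dmin : S q.
  by split; [split; [split; [split|]|]|] => //=; exact: ltW.
have : (1 - t) * (height X Y a' b' c - height X Y a' b' d) > 0.
  by rewrite mulr_gt0//; lra.
rewrite hqE; lra.
Qed.

(** Below the line the apex clears the view, so only blockers on or above the line have to be
    excluded separately. *)
Lemma sees_apex {a' b' c d : plane R} {x y : T} :
  crossing K X Y A B a b v w -> separating K X Y A B a' b' -> lower_apex a' b' d ->
  x != y -> K x c -> K y d -> 0 <= height X Y a' b' c -> X a' <= X c <= X b' ->
  (forall z t, z != x -> z != y -> 0 <= t <= 1 ->
    0 <= height X Y a' b' (point_at c d t) -> ~ K z (point_at c d t)) ->
  sees K x y.
Proof.
move=> C sep [od Yd hd _ free] xy Kc Kd hc strip upper.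
exists c, d; do 3![split=> //] => z zx zy; apply/seteqP; split=> // q [[t [t01 ->]]].
rewrite -/(point_at _ _ _) => Kq.
have [hq|hq] := leP 0 (height X Y a' b' (point_at c d t)); first exact: (upper z t).
have tne1 : t != 1.
  apply: contra zy => /eqP t1; apply/eqP.
  by apply: (cr_disjoint C _ _ d) => //; rewrite t1 point_at1 in Kq.
have t1 : 0 <= t < 1 by rewrite [t < 1]lt_neqAle tne1 andTb.
exact: (free c t hc strip t1 hq z Kq).
Qed.

(** Apart from its start, the view lies strictly below the line. *)
Lemma sees_apex_from_line {a' b' c d : plane R} {x y : T} :
  crossing K X Y A B a b v w -> separating K X Y A B a' b' -> lower_apex a' b' d ->
  x != y -> K x c -> K y d -> segment a' b' c -> sees K x y.
Proof.
move=> C sep apex xy Kc Kd sc.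
have XY := cr_chart C.
have ab := separating_lt C sep.
have hc := segment_height0 XY sc; have [_ _ hd _ _] := apex.
apply: (sees_apex C sep apex xy Kc Kd); first by rewrite hc.
  exact: (segment_strip XY ab sc).
move=> z t zx zy t01; rewrite (height_affine XY) hc => hq Kq.
have t0 : t = 0 by nra.
rewrite t0 point_at0 in Kq; move/eqP: zx; apply.
exact: (cr_disjoint C _ _ c).
Qed.

End Apex.

(** * Subsegments, and the [K4] to be found *)

Lemma compact_segment {R : realType} (p q : plane R) : compact (segment p q).
Proof.
have -> : segment p q = point_at p q @` `[0, 1].
  apply/seteqP; split=> [x [t [t01 ->]]|x [t]].
    by exists t => //=; rewrite in_itv.
  by rewrite /= in_itv /= => t01 <-; exists t.
apply: continuous_compact; last exact: segment_compact.
apply: continuous_subspaceT; apply: (@continuous_point_at _ _ (cst p) (cst q) id).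
- exact: cst_continuous.
- exact: cst_continuous.
- by move=> t; exact: cvg_id.
Qed.

Lemma segment_start {R : realType} (p q : plane R) : segment p q p.
Proof. by exists 0; split; [lra | rewrite -/(point_at p q 0) point_at0]. Qed.

Lemma segment_end {R : realType} (p q : plane R) : segment p q q.
Proof. by exists 1; split; [lra | rewrite -/(point_at p q 1) point_at1]. Qed.

Lemma subsegment {R : realType} {p q r z x : plane R} :
  segment p q r -> segment p q z -> segment r z x -> segment p q x.
Proof.
move=> [t [t01 ->]] [u [u01 ->]] [s [s01 ->]]; exists ((1 - s) * t + s * u); split.
  by apply/andP; split; nra.
rewrite !scalerDr !scalerA addrACA -!scalerDl; congr (_ *: _ + _); ring.
Qed.

Lemma segment_chart_inj {R : realType} {X Y : plane R -> R} {p q r z : plane R} :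
  affine_chart X Y -> X p < X q -> segment p q r -> segment p q z -> X r = X z -> r = z.
Proof.
move=> XY pq sr sz e; apply: (chart_inj XY) => //.
have D0 : X q - X p != 0 by rewrite gt_eqF// subr_gt0.
apply: (mulIf D0).
have := segment_height0 XY sr; have := segment_height0 XY sz.
by rewrite /height e; lra.
Qed.

(** The edge between [A] and [B] is left out, because the given sightline supplies it at the end. *)
Definition common_K4 {R : realType} {T : finType} (K : T -> set (plane R)) (A B : T) : Prop :=
  exists C D, [/\ uniq [:: A; B; C; D], sees K A C, sees K A D
    & [/\ sees K B C, sees K B D & sees K C D]].

Lemma common_K4_sym {R : realType} {T : finType} (K : T -> set (plane R)) (A B : T) :
  common_K4 K A B -> common_K4 K B A.
Proof.
move=> [C [D [unq AC AD [BC BD CD]]]]; exists C, D; split=> //.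
move: unq; rewrite /= !inE !negb_or eq_sym.
by move=> /andP[/and3P[-> -> ->] /andP[/andP[-> ->] ->]].
Qed.

(** * Tight segments touched from above only *)

Section Touched_above_left.
Context {R : realType} {T : finType} {K : T -> set (plane R)} {X Y : plane R -> R}.
Context {A B : T} {a b v w : plane R}.

Lemma untouched_below_sym {a' b' : plane R} :
  untouched_below K Y A B a' b' -> untouched_below K Y B A b' a'.
Proof. by move=> below p op Yp; rewrite segment_sym; apply: below => //; rewrite obstacleC. Qed.

Lemma common_K4_intro {c d : plane R} {C D : T} :
  crossing K X Y A B a b v w -> C != A -> C != B -> D != A -> D != B ->
  K C c -> K D d -> 0 < Y c -> Y d < 0 ->
  sees K A C -> sees K A D -> sees K B C -> sees K B D -> sees K C D -> common_K4 K A B.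
Proof.
move=> cr CA CB DA DB Kc Kd Yc Yd AC AD BC BD CD; exists C, D; split=> //.
have CD' : C != D.
  by apply/eqP => e; rewrite -e in Kd; exact: (obstacle_sign cr _ _ _ CA CB Kc Kd Yc Yd).
rewrite /= !inE !negb_or (crossing_neq cr) CD'.
by rewrite ![A == _]eq_sym ![B == _]eq_sym CA CB DA DB.
Qed.

(** A point of [A] or [B] strictly inside the segment would allow a narrower separating segment on
    the same line. *)
Lemma tight_inside {a' b' p : plane R} {z : T} :
  crossing K X Y A B a b v w -> tight K X Y A B a' b' ->
  segment a' b' p -> K z p -> X a' < X p < X b' -> (z != A) && (z != B).
Proof.
move=> C tg sp Kp /andP[ap pb].
have hp := segment_height0 (cr_chart C) sp.
apply/andP; split; apply/eqP => e; rewrite e in Kp.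
- by apply: (tight_start C tg Kp ap); rewrite hp//; left.
- by apply: (tight_end C tg Kp pb); rewrite hp//; left.
Qed.

(** By the last hypothesis no lower obstacle meets the piece from [a'] to [t] before [t]; the upper
    ones met there are cleared by tilting towards [p], which is below the line. *)
Lemma sees_touching {a' b' p t : plane R} {z : T} :
  crossing K X Y A B a b v w -> tight K X Y A B a' b' ->
  K A p -> height X Y a' b' p < 0 ->
  (z != A) && (z != B) -> K z t -> segment a' b' t ->
  (forall q, obstacle K A B q -> Y q < 0 -> segment a' t q -> q = t) ->
  sees K A z.
Proof.
move=> C tg Ap hp zAB Kt st only_t; have [sep _] := tg.
have XY := cr_chart C.
have ot : obstacle K A B t by exists z.
have /andP[at_ tb] := touch_inside C sep ot st.
have [zA zB] := andP zAB.
apply: (sees_by_tilting C sep Ap hp zA Kt st at_) => z' q z'A z'z Kq sq.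
have sq' := subsegment (segment_start _ _) st sq.
have /andP[aq qt] := segment_strip XY at_ sq.
have [Aa' _ _] := sep.
have aq' : X a' < X q.
  rewrite lt_neqAle aq andbT; apply/eqP => e; move/eqP: z'A; apply.
  apply: (cr_disjoint C _ _ a') => //.
  by rewrite (segment_chart_inj XY (separating_lt C sep) (segment_start _ _) sq' e).
have /andP[_ z'B] : (z' != A) && (z' != B).
  by apply: (tight_inside C tg sq' Kq); rewrite aq' (le_lt_trans qt).
split=> //.
have oq : obstacle K A B q by exists z' => //; exact/andP.
have := cr_off_axis C _ oq; rewrite neq_lt => /orP[Yq|//].
have qt' := only_t q oq Yq sq; rewrite qt' in Kq.
by move/eqP: z'z; case; exact: (cr_disjoint C _ _ t).
Qed.

(** Touching points with [Y >= 0] form a compact set, and [Y] does not vanish on obstacles, so its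
    rightmost point is strictly above the axis. *)
Lemma extreme_touch {a' b' c0 : plane R} :
  crossing K X Y A B a b v w -> obstacle K A B c0 -> 0 < Y c0 -> segment a' b' c0 ->
  exists c, [/\ obstacle K A B c, 0 < Y c, segment a' b' c &
    forall p, obstacle K A B p -> 0 < Y p -> segment a' b' p -> X p <= X c].
Proof.
move=> C oc Yc sc; have XY := cr_chart C.
have [cX cY] := (chart_contl XY, chart_contr XY).
pose S := obstacle K A B `&` segment a' b' `&` [set p | 0 <= Y p].
have cS : compact S.
  apply: compact_closedI; last exact: closed_ge0_preimage.
  apply: compact_closedI; first exact: (compact_obstacle C).
  by apply: compact_closed; [exact: norm_hausdorff | exact: compact_segment].
have Sc : S c0 by split; [split | exact: ltW].
have [c' [[oc' sc'] /= Yc'] max] :=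
  compact_argmin cS (ex_intro _ c0 Sc) (continuous_opp_fun cX).
exists c'; split=> //.
  by rewrite lt_neqAle eq_sym (cr_off_axis C _ oc').
move=> p op Yp sp; have := max p; rewrite lerN2; apply.
by split; [split | exact: ltW].
Qed.

(** The rightmost upper touching point [c] and the lower apex [d] give the two further vertices. [A]
    sees [c] by tilting towards [a], [B] sees it along the segment, and all three see the apex. *)
Lemma touched_above_left {a' b' c0 : plane R} :
  crossing K X Y A B a b v w -> tight K X Y A B a' b' ->
  untouched_below K Y A B a' b' ->
  obstacle K A B c0 -> 0 < Y c0 -> segment a' b' c0 -> height X Y a' b' a < 0 ->
  common_K4 K A B.
Proof.
move=> Cr tg below oc0 Yc0 sc0 ha; have [sep _] := tg.
have XY := cr_chart Cr; have ab := separating_lt Cr sep.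
have [c [oc Yc sc max]] := extreme_touch Cr oc0 Yc0 sc0.
have [d apex] := lower_apex_exists Cr tg below.
have [[C CAB Kc] [[D DAB Kd] Yd hd dstrip _]] := (oc, apex).
have [[CA CB] [DA DB]] := (andP CAB, andP DAB).
have /andP[ac cb] := touch_inside Cr sep oc sc.
have [Aa' Bb' _] := sep.
have [Aa _] := cr_start Cr.
have sa := segment_start a' b'.
have sb := segment_end a' b'.
have CD : C != D.
  by apply/eqP => e; rewrite -e in Kd; exact: (obstacle_sign Cr _ _ _ CA CB Kc Kd Yc Yd).
apply: (common_K4_intro Cr CA CB DA DB Kc Kd Yc Yd).
- apply: (sees_touching Cr tg Aa ha CAB Kc sc) => q oq Yq sq.
  by case: (below q oq Yq); exact: (subsegment (segment_start _ _) sc sq).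
- by apply: (sees_apex_from_line Cr sep apex _ Aa' Kd sa); rewrite eq_sym.
(* To the right of [c] nothing touches: lower obstacles never do, and [c] is the last upper touching
   point. *)
- apply: sees_sym; exists c, b'; do 3![split=> //] => z zC zB.
  apply/seteqP; split=> // q [sq Kq].
  have sq' := subsegment sc (segment_end _ _) sq.
  have /andP[cq qb] := segment_strip XY cb sq.
  have zA : z != A.
    apply/eqP => e; rewrite e in Kq; apply: (tight_start Cr tg Kq); first lra.
      by rewrite (segment_height0 XY sq').
    by left; exact: (segment_height0 XY sq').
  have oq : obstacle K A B q by exists z => //; exact/andP.
  have := cr_off_axis Cr _ oq; rewrite neq_lt => /orP[Yq|Yq].
    exact: (below q oq Yq).
  have qc : q = c.
    apply: (segment_chart_inj XY ab sq' sc); apply/eqP; rewrite eq_le cq andbT.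
    exact: max.
  rewrite qc in Kq; move/eqP: zC; apply.
  exact: (cr_disjoint Cr _ _ c).
- by apply: (sees_apex_from_line Cr sep apex _ Bb' Kd sb); rewrite eq_sym.
- exact: (sees_apex_from_line Cr sep apex CD Kc Kd sc).
Qed.

End Touched_above_left.

Section Touched_above.
Context {R : realType} {T : finType} {K : T -> set (plane R)} {X Y : plane R -> R}.
Context {A B : T} {a b v w : plane R}.

(** One of [a] and [b] is strictly below the line; a reflection makes it [a]. *)
Lemma touched_above {a' b' c : plane R} :
  crossing K X Y A B a b v w -> tight K X Y A B a' b' ->
  untouched_below K Y A B a' b' ->
  obstacle K A B c -> 0 < Y c -> segment a' b' c -> common_K4 K A B.
Proof.
move=> Cr tg below oc Yc sc; have [sep _] := tg.
have XY := cr_chart Cr; have ab := separating_lt Cr sep.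
have [ha|ha] := ltP (height X Y a' b' a) 0.
  exact: (touched_above_left Cr tg below oc Yc sc ha).
have [hb|hb] := ltP (height X Y a' b' b) 0.
  apply: common_K4_sym.
  apply: (touched_above_left (crossing_oppl Cr) (tight_oppl _ _ tg)
    (untouched_below_sym below) _ Yc); last by rewrite height_oppl.
    by rewrite obstacleC.
  by rewrite segment_sym.
have [[z _ Kc] [Aa Ya] [Bb Yb]] :=
  And3 oc (cr_start Cr) (cr_end Cr).
have /andP[ac cb] := cr_strip Cr z c Kc.
have Xa := cr_left Cr _ Aa.
have Xb := cr_right Cr _ Bb.
have hc := segment_height0 XY sc.
(* The point of [ab] with the abscissa of [c] is below [c], so below [a'b']. *)
have e : (X b - X a) * height X Y a' b' c
    = (X b - X c) * height X Y a' b' a + (X c - X a) * height X Y a' b' b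
      + Y c * ((X b - X a) * (X b' - X a')).
  by rewrite /height Ya Yb; ring.
have : 0 <= (X b - X c) * height X Y a' b' a by rewrite mulr_ge0//; lra.
have : 0 <= (X c - X a) * height X Y a' b' b by rewrite mulr_ge0//; lra.
have : 0 < Y c * ((X b - X a) * (X b' - X a')) by rewrite !mulr_gt0//; lra.
by move: e; rewrite hc mulr0; lra.
Qed.

(** Lower obstacles touch the segment from [d] onwards only, so tilting towards [a] clears the way
    to [c] and to [d]. *)
Lemma sees_both_touching {a' b' c d : plane R} {C D : T} :
  crossing K X Y A B a b v w -> tight K X Y A B a' b' -> height X Y a' b' a < 0 ->
  (C != A) && (C != B) -> (D != A) && (D != B) -> K C c -> K D d ->
  segment a' b' c -> segment a' b' d -> X c < X d ->
  (forall p, obstacle K A B p -> Y p < 0 -> segment a' b' p -> X d <= X p) ->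
  sees K A C /\ sees K A D.
Proof.
move=> Cr tg ha CAB DAB Kc Kd sc sd cd min; have [sep _] := tg.
have XY := cr_chart Cr; have ab := separating_lt Cr sep.
have [Aa _] := cr_start Cr.
have [oc od] : obstacle K A B c /\ obstacle K A B d by split; [exists C | exists D].
have /andP[ac _] := touch_inside Cr sep oc sc.
have /andP[ad _] := touch_inside Cr sep od sd.
split.
- apply: (sees_touching Cr tg Aa ha CAB Kc sc) => q oq Yq sq.
  have /andP[_ qc] := segment_strip XY ac sq.
  by exfalso; have := min q oq Yq (subsegment (segment_start _ _) sc sq); lra.
- apply: (sees_touching Cr tg Aa ha DAB Kd sd) => q oq Yq sq.
  have /andP[_ qd] := segment_strip XY ad sq.
  have sq' := subsegment (segment_start _ _) sd sq.
  apply: (segment_chart_inj XY ab sq' sd); apply/eqP.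
  by rewrite eq_le qd min.
Qed.

End Touched_above.

(** * Tight segments touched on both sides or on neither *)

Section Touched_both_or_untouched.
Context {R : realType} {T : finType} {K : T -> set (plane R)} {X Y : plane R -> R}.
Context {A B : T} {a b v w : plane R}.

(** An upper touching point left of a lower one forces the segment to descend, which puts [a] below
    its line and [b] above. The rightmost upper and the leftmost lower touching points see each
    other along the segment, and [A] and [B] reach both by tilting. *)
Lemma touched_both_ordered {a' b' c0 d0 : plane R} :
  crossing K X Y A B a b v w -> tight K X Y A B a' b' ->
  obstacle K A B c0 -> 0 < Y c0 -> segment a' b' c0 ->
  obstacle K A B d0 -> Y d0 < 0 -> segment a' b' d0 -> X c0 < X d0 -> common_K4 K A B.
Proof.
move=> Cr tg oc0 Yc0 sc0 od0 Yd0 sd0 cd0; have [sep _] := tg.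
have XY := cr_chart Cr; have ab := separating_lt Cr sep.
have D0 : 0 < X b' - X a' by lra.
have slope p q : segment a' b' p -> segment a' b' q ->
    (X b' - X a') * (Y p - Y q) = (Y b' - Y a') * (X p - X q).
  move=> sp sq; have := segment_height0 XY sp; have := segment_height0 XY sq.
  by rewrite /height; lra.
have ba : Y b' - Y a' < 0.
  have : 0 < (X b' - X a') * (Y c0 - Y d0) by rewrite mulr_gt0//; lra.
  by rewrite slope// nmulr_lgt0//; lra.
have [c [oc Yc sc max]] := extreme_touch Cr oc0 Yc0 sc0.
(* A half-turn, exchanging [A] with [B] and upper with lower obstacles. *)
have Cr' := crossing_oppl (crossing_oppr Cr).
have [d [od Yd sd min]] : exists d, [/\ obstacle K A B d, Y d < 0, segment a' b' d &
    forall p, obstacle K A B p -> Y p < 0 -> segment a' b' p -> X d <= X p].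
  have Yd0' : 0 < - Y d0 by lra.
  have od0' : obstacle K B A d0 by rewrite obstacleC.
  have [d [od Yd sd min]] := extreme_touch Cr' od0' Yd0' sd0.
  exists d; rewrite obstacleC; split=> //; first lra.
  by move=> p op Yp sp; rewrite -lerN2; apply: min => //; lra.
(* On a descending line higher means further left, so the extreme touching points are ordered like
   [c0] and [d0]. *)
have cd : X c < X d.
  have : 0 < (X b' - X a') * (Y c - Y d) by rewrite mulr_gt0//; lra.
  by rewrite slope// nmulr_rgt0//; lra.
have [[C CAB Kc] [D DAB Kd]] := (oc, od).
have [[CA CB] [DA DB]] := (andP CAB, andP DAB).
have [[Aa Ya] [Bb Yb]] :=
  (cr_start Cr, cr_end Cr).
have /andP[ac _] := cr_strip Cr C c Kc.
have /andP[_ db] := cr_strip Cr D d Kd.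
have hE p q : segment a' b' p -> Y q = 0 ->
    height X Y a' b' q = (Y b' - Y a') * (X p - X q) - (X b' - X a') * Y p.
  by move=> /(segment_height0 XY); rewrite /height => + ->; lra.
(* The line is above the axis at [c] and descends, hence it is above the axis at [a], which is not
   to the right of [c]. *)
have ha : height X Y a' b' a < 0.
  rewrite (hE c a sc Ya).
  have : 0 < (X b' - X a') * Y c by exact: mulr_gt0.
  have : (Y b' - Y a') * (X c - X a) <= 0 by rewrite mulr_le0_ge0//; lra.
  lra.
have hb : 0 < height X Y a' b' b.
  rewrite (hE d b sd Yb).
  have : (X b' - X a') * Y d < 0 by rewrite pmulr_rlt0.
  have : 0 <= (Y b' - Y a') * (X d - X b) by rewrite mulr_le0//; lra.
  lra.
have [AC AD] := sees_both_touching Cr tg ha CAB DAB Kc Kd sc sd cd min.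
have [BD BC] : sees K B D /\ sees K B C.
  apply: (sees_both_touching Cr' (tight_oppl _ _ (tight_oppr _ _ tg)) _ _ _ Kd Kc).
  - by rewrite height_oppl height_oppr oppr_lt0.
  - by rewrite DA DB.
  - by rewrite CA CB.
  - by rewrite segment_sym.
  - by rewrite segment_sym.
  - by rewrite ltrN2.
  - move=> p; rewrite obstacleC segment_sym lerN2 oppr_lt0; exact: max.
apply: (common_K4_intro Cr CA CB DA DB Kc Kd Yc Yd) => //.
exists c, d; split.
  by apply/eqP => e; rewrite -e in Kd; exact: (obstacle_sign Cr _ _ _ CA CB Kc Kd Yc Yd).
do 2![split=> //] => z zC zD; apply/seteqP; split=> // q [sq Kq].
have /andP[ac' cb'] := touch_inside Cr sep oc sc.
have /andP[ad' db'] := touch_inside Cr sep od sd.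
have /andP[cq qd] := segment_strip XY cd sq.
have sq' := subsegment sc sd sq.
have zAB : (z != A) && (z != B).
  by apply: (tight_inside Cr tg sq' Kq); apply/andP; split; lra.
have oq : obstacle K A B q by exists z.
have := cr_off_axis Cr _ oq; rewrite neq_lt => /orP[Yq|Yq].
  have e : q = d.
    by apply: (segment_chart_inj XY ab sq' sd); apply/eqP; rewrite eq_le qd min.
  rewrite e in Kq; move/eqP: zD; apply.
  exact: (cr_disjoint Cr _ _ d).
have e : q = c.
  by apply: (segment_chart_inj XY ab sq' sc); apply/eqP; rewrite eq_le cq max.
rewrite e in Kq; move/eqP: zC; apply.
exact: (cr_disjoint Cr _ _ c).
Qed.

(** The apexes of the two sides give the two further vertices. Between them, each apex clears its
    own side of the line, and the segment meets the line at a point of [a'b'], where no region can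
    be. *)
Lemma untouched {a' b' : plane R} :
  crossing K X Y A B a b v w -> tight K X Y A B a' b' ->
  untouched_below K Y A B a' b' -> untouched_below K (fun p => - Y p) A B a' b' ->
  common_K4 K A B.
Proof.
move=> Cr tg below above; have [sep _] := tg.
have XY := cr_chart Cr; have ab := separating_lt Cr sep.
have [d apexd] := lower_apex_exists Cr tg below.
have Cr' := crossing_oppr Cr.
have [c apexc] := lower_apex_exists Cr' (tight_oppr _ _ tg) above.
have sep' : separating K X (fun p => - Y p) A B a' b' by exact/separating_oppr.
have [[D DAB Kd] Yd hd _ _] := apexd.
have [[C CAB Kc] Yc hc strip free] := apexc.
have {}Yc : 0 < Y c by lra.
have [[CA CB] [DA DB]] := (andP CAB, andP DAB).
have [Aa' Bb' _] := sep.
have [sa sb] := (segment_start a' b', segment_end a' b').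
apply: (common_K4_intro Cr CA CB DA DB Kc Kd Yc Yd).
- by apply: (sees_apex_from_line Cr' sep' apexc _ Aa' Kc sa); rewrite eq_sym.
- by apply: (sees_apex_from_line Cr sep apexd _ Aa' Kd sa); rewrite eq_sym.
- by apply: (sees_apex_from_line Cr' sep' apexc _ Bb' Kc sb); rewrite eq_sym.
- by apply: (sees_apex_from_line Cr sep apexd _ Bb' Kd sb); rewrite eq_sym.
have {}hc : 0 < height X Y a' b' c by move: hc; rewrite height_oppr; lra.
have /andP[ac cb] := strip.
apply: (sees_apex Cr sep apexd _ Kc Kd); [|exact: ltW|by apply/andP; split; lra|].
  by apply/eqP => e; rewrite -e in Kd; exact: (obstacle_sign Cr _ _ _ CA CB Kc Kd Yc Yd).
move=> z t zC zD t01; rewrite le_eqVlt => /orP[/eqP hq|hq] Kq.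
- have [_ _ _ /andP[ad db] _] := apexd.
  have qstrip : X a' < X (point_at c d t) < X b'.
    rewrite (chart_affl XY); have [->|tne0] := eqVneq t 0.
      by rewrite subr0 mul1r mul0r addr0.
    have t0 : 0 < t by rewrite lt_neqAle eq_sym tne0; case/andP: t01.
    have : 0 < t * (X d - X a') by rewrite mulr_gt0//; lra.
    have : 0 < t * (X b' - X d) by rewrite mulr_gt0//; lra.
    by move=> ? ?; apply/andP; split; nra.
  have sq : segment a' b' (point_at c d t).
    by apply: (height0_segment XY ab) => //; case/andP: qstrip => *; apply/andP; split; lra.
  have zAB := tight_inside Cr tg sq Kq qstrip.
  have oq : obstacle K A B (point_at c d t) by exists z.
  have := cr_off_axis Cr _ oq; rewrite neq_lt => /orP[Yq|Yq].
    exact: (below _ oq Yq).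
  by apply: (above _ oq _ sq); lra.
- have t0 : t != 0.
    apply: contra zC => /eqP t0; rewrite t0 point_at0 in Kq; apply/eqP.
    exact: (cr_disjoint Cr _ _ c).
  have t0' : 0 < t by rewrite lt_neqAle eq_sym t0; case/andP: t01.
  (* Read from [d] in the reflected chart, this part of the view lies below the line, so the upper
     apex [c] clears it. *)
  rewrite point_atC in Kq hq; apply: (free d (1 - t) _ _ _ _ z Kq).
  + by rewrite height_oppr; lra.
  + by have [_ _ _ /andP[? ?] _] := apexd; apply/andP; split; lra.
  + by apply/andP; split; lra.
  + by rewrite height_oppr; lra.
Qed.

End Touched_both_or_untouched.

(** * The case distinction for a crossing *)

Section Crossing_K4.
Context {R : realType} {T : finType} {K : T -> set (plane R)} {X Y : plane R -> R}.
Context {A B : T} {a b v w : plane R}.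

(** An up-down reflection puts the upper touching point on the left; equal abscissas would make the
    two points coincide in spite of their signs. *)
Lemma touched_both {a' b' c d : plane R} :
  crossing K X Y A B a b v w -> tight K X Y A B a' b' ->
  obstacle K A B c -> 0 < Y c -> segment a' b' c ->
  obstacle K A B d -> Y d < 0 -> segment a' b' d -> common_K4 K A B.
Proof.
move=> Cr tg oc Yc sc od Yd sd; have [sep _] := tg.
have XY := cr_chart Cr; have ab := separating_lt Cr sep.
have [cd|dc|e] := ltgtP (X c) (X d).
- exact: (touched_both_ordered Cr tg oc Yc sc od Yd sd).
- apply: (touched_both_ordered (crossing_oppr Cr) (tight_oppr _ _ tg) od _ sd oc _ sc) => //; lra.
- have cd := segment_chart_inj XY ab sc sd e.
  by exfalso; rewrite cd in Yc; lra.
Qed.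

Lemma crossing_common_K4 : crossing K X Y A B a b v w -> common_K4 K A B.
Proof.
move=> Cr; have [a' [b' tg]] := tight_exists Cr.
have touchP (Z : plane R -> R) : untouched_below K Z A B a' b' \/
    exists p, [/\ obstacle K A B p, Z p < 0 & segment a' b' p].
  have [|nt] := pselect (exists p, [/\ obstacle K A B p, Z p < 0 & segment a' b' p]).
    by right.
  by left=> p op Zp sp; apply: nt; exists p.
have [below|[d [od Yd sd]]] := touchP Y;
  have [above|[c [oc Yc sc]]] := touchP (fun p => - Y p).
- exact: (untouched Cr tg below above).
- by apply: (touched_above Cr tg below oc _ sc); lra.
- apply: (touched_above (crossing_oppr Cr) (tight_oppr _ _ tg) above od _ sd); lra.
- by apply: (touched_both Cr tg oc _ sc od Yd sd); lra.
Qed.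

End Crossing_K4.

(** * Clipping the regions to a quadrilateral *)

Lemma chart_swap {R : realType} {X Y : plane R -> R} :
  affine_chart X Y -> affine_chart Y X.
Proof. by case=> cX cY aX aY inj; split=> // p q eY eX; exact: inj. Qed.

(** For endpoints on the axes this is the convex hull of the four points: half-planes bounded by the
    lines [bv], [bw], [av], [aw], in this order, with denominators cleared. *)
Definition quadrilateral {R : realType} (X Y : plane R -> R) (a b v w : plane R) :
    set (plane R) :=
  [set p | Y v * X p + X b * Y p - X b * Y v <= 0] `&`
  [set p | - (Y w * X p) - X b * Y p + X b * Y w <= 0] `&`
  [set p | - (Y v * X p) - X a * Y p + X a * Y v <= 0] `&`
  [set p | Y w * X p + X a * Y p - X a * Y w <= 0].

Definition crossing_axes {R : realType} (X Y : plane R -> R) (a b v w : plane R) : Prop :=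
  [/\ X a < 0 < X b, Y a = 0, Y b = 0 & [/\ Y w < 0 < Y v, X v = 0 & X w = 0]].

Section Clip.
Context {R : realType} {X Y : plane R -> R} {a b v w : plane R}.
Context (XY : affine_chart X Y) (axes : crossing_axes X Y a b v w).

Local Notation Q := (quadrilateral X Y a b v w).

Lemma closed_quadrilateral : closed Q.
Proof.
have [cX cY] := (chart_contl XY, chart_contr XY).
have cst (c : R) : continuous (fun _ : plane R => c) by exact: cst_continuous.
have half (k l m : R) : closed [set p | k * X p - l * Y p - m <= 0].
  by apply: closed_le0_preimage; repeat first [exact: cX | exact: cY | exact: cst
    | apply: continuous_sub_fun | apply: continuous_mul_fun].
have {}half (k l m : R) (f : plane R -> R) :
    (forall p, f p = k * X p - l * Y p - m) -> closed [set p | f p <= 0].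
  by move=> /funext ->; exact: half.
apply: closedI; [apply: closedI; [apply: closedI|]|].
- by apply: (half (Y v) (- X b) (X b * Y v)) => p; ring.
- by apply: (half (- Y w) (X b) (- (X b * Y w))) => p; ring.
- by apply: (half (- Y v) (X a) (- (X a * Y v))) => p; ring.
- by apply: (half (Y w) (- X a) (X a * Y w)) => p; ring.
Qed.

Lemma convex_quadrilateral : convex_region Q.
Proof.
move=> p q [[[/= p1 p2] p3] p4] [[[/= q1 q2] q3] q4] x [t [t01 ->]].
rewrite -/(point_at p q t).
have [t0 t1] : 0 <= t /\ 0 <= 1 - t by split; lra.
have conv (f g : R) : f <= 0 -> g <= 0 -> (1 - t) * f + t * g <= 0.
  by move=> f0 g0; nra.
split; [split; [split|]|] => /=; rewrite (chart_affl XY) (chart_affr XY).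
- by have := conv _ _ p1 q1; lra.
- by have := conv _ _ p2 q2; lra.
- by have := conv _ _ p3 q3; lra.
- by have := conv _ _ p4 q4; lra.
Qed.

Lemma quadrilateral_strip {p : plane R} : Q p -> X a <= X p <= X b.
Proof.
have [/andP[Xa Xb] Ya Yb [/andP[Yw Yv] Xv Xw]] := axes.
move=> [[[/= p1 p2] p3] p4]; have [Yp|Yp] := leP 0 (Y p).
  have : 0 <= X b * Y p by rewrite mulr_ge0//; lra.
  have : 0 <= - X a * Y p by rewrite mulr_ge0//; lra.
  move=> ? ?; apply/andP; split; rewrite -subr_ge0 -(pmulr_rge0 _ Yv); lra.
have : 0 <= X b * - Y p by rewrite mulr_ge0//; lra.
have : 0 <= - X a * - Y p by rewrite mulr_ge0//; lra.
have Yw' : 0 < - Y w by lra.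
move=> ? ?; apply/andP; split; rewrite -subr_ge0 -(pmulr_rge0 _ Yw'); lra.
Qed.

Lemma quadrilateral_horizontal {p : plane R} : Q p -> Y p = 0 -> segment a b p.
Proof.
have [/andP[Xa Xb] Ya Yb [/andP[Yw Yv] Xv Xw]] := axes.
move=> Qp Yp; apply: (height0_segment XY); first lra.
  exact: quadrilateral_strip.
by rewrite /height Ya Yb Yp; ring.
Qed.

Lemma quadrilateral_vertical {p : plane R} : Q p -> X p = 0 -> segment v w p.
Proof.
have [/andP[Xa Xb] Ya Yb [/andP[Yw Yv] Xv Xw]] := axes.
move=> [[[/= p1 p2] p3] p4] Xp; rewrite segment_sym.
apply: (height0_segment (chart_swap XY)); first lra.
  by apply/andP; split; rewrite -subr_ge0 -(pmulr_rge0 _ Xb); rewrite Xp in p1 p2; lra.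
by rewrite /height Xv Xw Xp; ring.
Qed.

Lemma quadrilateral_vertices : [/\ Q a, Q b, Q v & Q w].
Proof.
have [/andP[Xa Xb] Ya Yb [/andP[Yw Yv] Xv Xw]] := axes.
have [pa pb] : 0 < - X a /\ 0 < - Y w by lra.
have := mulr_gt0 Xb Yv; have := mulr_gt0 Xb pb.
have := mulr_gt0 pa Yv; have := mulr_gt0 pa pb => e1 e2 e3 e4.
by split; (split; [split; [split|]|]) => /=; rewrite ?Xv ?Xw ?Ya ?Yb; lra.
Qed.

(** Inside the quadrilateral the axes are just the two sightlines, so regions that do not own a
    sightline stay off its axis. By convexity the clipped [A] and [B] then stay on the sides of [a]
    and [b]. *)
Lemma clipped_crossing {T : finType} {reg : T -> set (plane R)} {A B V W : T} :
  (forall z, convex_region (reg z) /\ compact (reg z)) ->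
  (forall y z, y != z -> reg y `&` reg z = set0) ->
  uniq [:: A; B; V; W] -> sightline reg A B a b -> sightline reg V W v w ->
  crossing (fun z => reg z `&` Q) X Y A B a b v w.
Proof.
move=> regP disj unq [_ [Aa [Bb freeAB]]] [_ [Vv [Ww freeVW]]].
have [/andP[Xa Xb] Ya Yb [/andP[Yw Yv] Xv Xw]] := axes.
have [Qa Qb Qv Qw] := quadrilateral_vertices.
move: unq; rewrite /= !inE !negb_or => /and4P[/and3P[_ AV AW] /andP[BV BW] _ _].
have nonzero z p : z != V -> z != W -> reg z p -> Q p -> X p != 0.
  move=> zV zW zp Qp; apply/eqP => Xp.
  suff : (segment v w `&` reg z) p by rewrite freeVW.
  by split=> //; exact: quadrilateral_vertical.
have same_side z p q : z != V -> z != W -> (reg z `&` Q) p -> (reg z `&` Q) q ->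
    X p < 0 -> X q < 0.
  move=> zV zW [zp Qp] [zq Qq] Xp; rewrite ltNge; apply/negP => Xq.
  have Dn0 : X p - X q != 0 by rewrite lt_eqF//; lra.
  pose t := X p / (X p - X q).
  have t01 : 0 <= t <= 1.
    rewrite /t -mulrNN -invrN opprB divr_ge0 ?ler_pdivrMr ?mul1r; lra.
  have st : segment p q (point_at p q t) by exists t.
  have := nonzero z _ zV zW ((regP z).1 _ _ zp zq _ st) (convex_quadrilateral _ _ Qp Qq _ st).
  by rewrite (chart_affl XY) => /eqP[]; rewrite /t; field.
have obstacleQ z p : z != A -> z != B -> reg z p -> Q p ->
    obstacle (fun z => reg z `&` Q) A B p.
  by move=> zA zB zp Qp; exists z => //; exact/andP.
split=> //.
- move=> z; apply: compact_closedI; first exact: (regP z).2.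
  exact: closed_quadrilateral.
- move=> z p q t t01 [zp Qp] [zq Qq].
  have st : segment p q (point_at p q t) by exists t.
  by split; [exact: ((regP z).1 _ _ zp zq) | exact: (convex_quadrilateral _ _ Qp Qq)].
- move=> y z p [yp _] [zp _]; apply/eqP/negPn/negP => /disj yz.
  by suff : (reg y `&` reg z) p by rewrite yz.
- by move=> p Ap; apply: (same_side A a p) => //; split.
- move=> p Bp; have [Bp' Qp] := Bp; rewrite ltNge le_eqVlt; apply/negP => /orP[/eqP|] Xp.
    by move/eqP: (nonzero B p BV BW Bp' Qp).
  have : X b < 0 by apply: (same_side B p b) => //; split.
  lra.
- move=> p [z /andP[zA zB] [zp Qp]]; apply/eqP => Yp.
  suff : (segment a b `&` reg z) p by rewrite freeAB.
  by split=> //; exact: quadrilateral_horizontal.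
- by split=> //; apply: (obstacleQ V) => //; rewrite eq_sym.
- by split=> //; apply: (obstacleQ W) => //; rewrite eq_sym.
- by move=> z p [_ Qp]; exact: quadrilateral_strip.
Qed.

End Clip.

(** A segment between points of the convex [Q] stays in [Q], so clipping has removed no blocker from
    it. *)
Lemma sees_clip {R : realType} {T : finType} {reg : T -> set (plane R)}
    {Q : set (plane R)} {x y : T} :
  convex_region Q -> sees (fun z => reg z `&` Q) x y -> sees reg x y.
Proof.
move=> convQ [p [q [xy [[xp Qp] [[yq Qq] free]]]]]; exists p, q; do 3![split=> //].
move=> z zx zy; apply/seteqP; split=> // r [sr zr].
suff : (segment p q `&` (reg z `&` Q)) r by rewrite free.
by do 2![split=> //]; exact: convQ Qp Qq _ sr.
Qed.

(** * Coordinates adapted to two crossing segments *)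

Definition det2 {R : realType} (p q : plane R) : R := p 0 0 * q 0 1 - p 0 1 * q 0 0.

Lemma plane_eq {R : realType} (p q : plane R) : p 0 0 = q 0 0 -> p 0 1 = q 0 1 -> p = q.
Proof.
move=> e0 e1; apply/rowP => i.
have [->|->] : i = 0 \/ i = 1 by case: i => -[|[|//]] i2; [left|right]; exact: val_inj.
all: by [].
Qed.

(** Each coordinate is a multiple of the signed distance to a line, of direction [u] through [v] or
    of direction [s] through [a]. The directions are independent, and Cramer's rule gives
    injectivity. *)
Lemma det2_chart {R : realType} (u s v a : plane R) (k : R) :
  det2 u s != 0 -> k != 0 ->
  affine_chart (fun p : plane R => k * det2 u (p - v)) (fun p : plane R => k * det2 s (p - a)).
Proof.
move=> us k0.
have ccont (i : 'I_2) : continuous (fun p : plane R => p 0 i) by exact: coord_continuous.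
have cst (c : R) : continuous (fun _ : plane R => c) by exact: cst_continuous.
have cdet (r c : plane R) : continuous (fun p : plane R => k * det2 r (p - c)).
  have -> : (fun p : plane R => k * det2 r (p - c)) =
      (fun p : plane R => k * (r 0 0 * (p 0 1 - c 0 1) - r 0 1 * (p 0 0 - c 0 0))).
    by apply/funext => p; rewrite /det2 !mxE.
  by repeat first [exact: ccont | exact: cst
    | apply: continuous_sub_fun | apply: continuous_mul_fun].
split=> //.
- by move=> p q t; rewrite /det2 /point_at !mxE; ring.
- by move=> p q t; rewrite /det2 /point_at !mxE; ring.
move=> p q /(mulfI k0) eu /(mulfI k0) es.
move: eu es; rewrite /det2 !mxE => eu es.
have solve (i : 'I_2) : det2 u s * (p 0 i - q 0 i) = 0 -> p 0 i = q 0 i.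
  by move/eqP; rewrite mulf_eq0 (negPf us) /= subr_eq0 => /eqP.
have {}eu : u 0 0 * (p 0 1 - q 0 1) = u 0 1 * (p 0 0 - q 0 0) by lra.
have {}es : s 0 0 * (p 0 1 - q 0 1) = s 0 1 * (p 0 0 - q 0 0) by lra.
apply: plane_eq; apply: solve; rewrite /det2.
  have -> : (u 0 0 * s 0 1 - u 0 1 * s 0 0) * (p 0 0 - q 0 0)
    = u 0 0 * (s 0 1 * (p 0 0 - q 0 0)) - s 0 0 * (u 0 1 * (p 0 0 - q 0 0)) by ring.
  by rewrite -eu -es; ring.
have -> : (u 0 0 * s 0 1 - u 0 1 * s 0 0) * (p 0 1 - q 0 1)
  = s 0 1 * (u 0 0 * (p 0 1 - q 0 1)) - u 0 1 * (s 0 0 * (p 0 1 - q 0 1)) by ring.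
by rewrite eu es; ring.
Qed.

Lemma det2_eq0 {R : realType} (u s : plane R) :
  u != 0 -> det2 u s = 0 -> exists l, s = l *: u.
Proof.
move=> u0; rewrite /det2 => /eqP; rewrite subr_eq0 => /eqP e.
have [u00|u00] := eqVneq (u 0 0) 0; last first.
  exists (s 0 0 / u 0 0); apply: plane_eq; rewrite mxE; first by field.
  apply: (mulfI u00); rewrite e; field.
  by [].
have u01 : u 0 1 != 0.
  by apply: contra u0 => /eqP u01; apply/eqP; apply: plane_eq; rewrite mxE.
exists (s 0 1 / u 0 1); apply: plane_eq; rewrite mxE; last by field.
apply: (mulfI u01); rewrite -e u00; ring.
Qed.

(* Of two overlapping collinear segments, one has an endpoint on the other. *)
Lemma crossing_not_parallel {R : realType} (a b v w : plane R) :
  a != b -> v != w -> segment a b `&` segment v w !=set0 ->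
  ~ segment v w a -> ~ segment v w b -> ~ segment a b v -> det2 (w - v) (b - a) != 0.
Proof.
move=> ab vw [x [[t [t01 xab]] [s [s01 xvw]]]] nA nB nV; apply/eqP => /det2_eq0.
rewrite subr_eq0 eq_sym => /(_ vw) [l bal].
have l0 : l != 0.
  by apply: contra ab => /eqP l0; rewrite eq_sym -subr_eq0 bal l0 scale0r.
have coord i : b 0 i = a 0 i + l * (w 0 i - v 0 i).
  by have := congr1 (fun p : plane R => p 0 i) bal; rewrite !mxE; lra.
have meet i : (1 - t) * a 0 i + t * b 0 i = (1 - s) * v 0 i + s * w 0 i.
  by have := congr1 (fun p : plane R => p 0 i) (etrans (esym xab) xvw); rewrite !mxE.
(* The parameters of [a] and [b] on the line [vw]. *)
pose al := s - t * l; pose be := s + (1 - t) * l.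
have aE i : a 0 i = (1 - al) * v 0 i + al * w 0 i.
  by have := meet i; rewrite (coord i) /al; lra.
have bE i : b 0 i = (1 - be) * v 0 i + be * w 0 i.
  by rewrite coord aE /al /be; ring.
have al01 : ~ 0 <= al <= 1.
  by move=> al01; apply: nA; exists al; split=> //; apply: plane_eq; rewrite !mxE aE.
have be01 : ~ 0 <= be <= 1.
  by move=> be01; apply: nB; exists be; split=> //; apply: plane_eq; rewrite !mxE bE.
(* [- al / l] is the parameter of [v] on the line [ab]. *)
have v01 : ~ 0 <= - al / l <= 1.
  move=> v01; apply: nV; exists (- al / l); split=> //.
  by apply: plane_eq; rewrite !mxE coord aE; field.
have sE : s = (1 - t) * al + t * be by rewrite /al /be; ring.
have lE : l = be - al by rewrite /al /be; ring.
have [t0 t1] := andP t01; have [s0 s1] := andP s01.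
(* As [s] lies in the unit interval and between [al] and [be], which are both outside it, these are
   on opposite sides of it; then [v] is between [a] and [b]. *)
have [al0|al0] := ltP al 0.
  have [be1|be1] := leP be 1.
    have be0 : be < 0 by rewrite ltNge; apply/negP => be0; apply: be01; rewrite be0.
    nra.
  apply: v01; rewrite divr_ge0 ?ler_pdivrMr ?mul1r; lra.
have al1 : 1 < al by rewrite ltNge; apply/negP => al1; apply: al01; rewrite al0.
have [be0|be0] := leP 0 be.
  have be1 : 1 < be by rewrite ltNge; apply/negP => be1; apply: be01; rewrite be0.
  nra.
apply: v01; rewrite -mulrNN -invrN opprK divr_ge0 ?ler_pdivrMr ?mul1r; lra.
Qed.

(** * From crossing sightlines to the [K4] *)

Theorem theorem3 (R : realType) (T : finType) (e : rel T)
  (reg : T -> set (plane R)) (A B V W : T) (a b v w : plane R) :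
  simple_graph e ->
  convex_compact_visibility_rep e reg ->
  uniq [:: A; B; V; W] ->
  sightline reg A B a b ->
  sightline reg V W v w ->
  segment a b `&` segment v w !=set0 ->
  in_common_K4 e A B.
Proof.
move=> _ [[[_ [_ disj]] vis] regP] unq sAB sVW cross.
have [AB [Aa [Bb freeAB]]] := sAB; have [VW [Vv [Ww freeVW]]] := sVW.
have := unq; rewrite /= !inE !negb_or => /and4P[/and3P[_ AV AW] /andP[BV BW] _ _].
have neq y z p q : y != z -> reg y p -> reg z q -> p != q.
  move=> /disj yz yp zq; apply/eqP => pq; rewrite -pq in zq.
  by suff : (reg y `&` reg z) p by rewrite yz.
have avoid (S : set (plane R)) z p : S `&` reg z = set0 -> reg z p -> ~ S p.
  by move=> S0 zp Sp; suff : (S `&` reg z) p by rewrite S0.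
have nA := avoid _ A a (freeVW A AV AW) Aa.
have nB := avoid _ B b (freeVW B BV BW) Bb.
have VA : V != A by rewrite eq_sym.
have VB : V != B by rewrite eq_sym.
have WA : W != A by rewrite eq_sym.
have WB : W != B by rewrite eq_sym.
have nV := avoid _ V v (freeAB V VA VB) Vv.
have nW := avoid _ W w (freeAB W WA WB) Ww.
have dn0 := crossing_not_parallel a b v w (neq _ _ _ _ AB Aa Bb) (neq _ _ _ _ VW Vv Ww)
  cross nA nB nV.
set u := w - v in dn0; set s := b - a in dn0; set d := det2 u s in dn0.
(* Scaling by the determinant [d] itself makes [X b - X a] and [Y v - Y w] equal to the positive
   [d * d], whatever the orientation. *)
have XY := det2_chart u s v a d dn0 dn0.
set X := (fun p : plane R => d * det2 u (p - v)) in XY.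
set Y := (fun p : plane R => d * det2 s (p - a)) in XY.
have d2 : 0 < d * d by rewrite -expr2 exprn_even_gt0//= dn0.
have [Ya Yb Xv Xw] : [/\ Y a = 0, Y b = 0, X v = 0 & X w = 0].
  by split; rewrite /X /Y /det2 /u /s !mxE; ring.
have Xab : X b = X a + d * d.
  by rewrite /X /d /det2 /u /s !mxE; ring.
have Yvw : Y v = Y w + d * d.
  by rewrite /Y /d /det2 /u /s !mxE; ring.
have [x [[t [t01 xab]] [r [r01 xvw]]]] := cross.
(* The crossing point is the origin of the chart, so [t] and [r] determine the coordinates of the
   endpoints. *)
have Xx : X x = 0 by rewrite xvw -/(point_at v w r) (chart_affl XY) Xv Xw; ring.
have Yx : Y x = 0 by rewrite xab -/(point_at a b t) (chart_affr XY) Ya Yb; ring.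
have XaE : X a = - (t * (d * d)).
  by move: Xx; rewrite xab -/(point_at a b t) (chart_affl XY) Xab; lra.
have YwE : Y w = - ((1 - r) * (d * d)).
  by move: Yx; rewrite xvw -/(point_at v w r) (chart_affr XY) Yvw; lra.
(* Each sightline misses the endpoints of the other, so the crossing point is none of the four and
   both parameters are strictly inside the unit interval. *)
have inside p q (k : R) : 0 <= k <= 1 -> x = point_at p q k -> x != p -> x != q -> 0 < k < 1.
  move=> /andP[k0 k1] xE xp xq; rewrite !lt_neqAle k0 k1 !andbT; apply/andP; split.
    by apply: contra xp => /eqP k0'; rewrite xE -k0' point_at0.
  by apply: contra xq => /eqP k1'; rewrite xE k1' point_at1.
have sx : segment a b x by exists t.
have sx' : segment v w x by exists r.
have /andP[t0 t1] : 0 < t < 1.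
  by apply: (inside a b) => //; apply/eqP => xE; [apply: nA|apply: nB]; rewrite -xE.
have /andP[r0 r1] : 0 < r < 1.
  by apply: (inside v w) => //; apply/eqP => xE; [apply: nV|apply: nW]; rewrite -xE.
have Xa : X a < 0 by rewrite XaE oppr_lt0 mulr_gt0.
have Xb : 0 < X b.
  by have := mulr_gt0 (_ : 0 < 1 - t) d2; rewrite subr_gt0 => /(_ t1); lra.
have Yw : Y w < 0 by rewrite YwE oppr_lt0 mulr_gt0// subr_gt0.
have Yv : 0 < Y v by have := mulr_gt0 r0 d2; lra.
have axes : crossing_axes X Y a b v w by split; [|..|split] => //; apply/andP.
have [C [D [unq' AC AD [BC BD CD]]]] := crossing_common_K4
  (clipped_crossing XY axes regP disj unq sAB sVW).
have edge y z : sees (fun z => reg z `&` quadrilateral X Y a b v w) y z -> e y z.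
  move=> /(sees_clip (convex_quadrilateral XY)) syz.
  by have [p [q [yz _]]] := syz; apply/(vis _ _ yz).
exists C, D; split=> //; try exact: edge.
  by apply/(vis _ _ AB); exists a, b.
by split; exact: edge.
Qed.
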